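(* Let $\ell=a_1|f_1|+\dots+a_m|f_m|$ be a positive linear combination of non-constant absolute polynomials on $\mathcal B^n$, i.e. $a_i>0$ real and $f_i\in K[x_1,\dots,x_n]$ non-constant, and denote the projective closure of the zero locus of $f_i$ by $V_i\subseteq\mathbb P^n$. Suppose further that $f_i=g_i^{m_i}$ where $m_i>0$ is an integer and $g_i=\sum_{j=1}^n a_{i,j}x_j+b_i$ for some $a_{i,j},b_i\in K$. Then $\ell$ has a global minimum in $\mathcal B^n$ if - the $V_i$ intersect in $K^n$, i.e. $V_1\cap\dots\cap V_m\cap K^n\neq\emptyset$; or - the $V_i$ never intersect, i.e. $V_1\cap\dots\cap V_m=\emptyset$. In particular, if $(V_1\cap\dots\cap V_m)\setminus K^n=\emptyset$ then $\ell$ has a global minimum.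
   Context: $K$ is a field with a non-trivial valuation $\mathrm{val}\colon K\to\mathbb R\cup\{\infty\}$, complete with respect to the associated non-Archimedean absolute value $|a|=\exp(-\mathrm{val}(a))$ ($K$ is not assumed locally compact). $\hat K$ is the completion of an algebraic closure of $K$, with the unique extension of $|\cdot|$. For $a\in K^n$, $r\in\mathbb R_{\ge0}^n$ put $B_{\mathcal B}(a,r)=\{z\in\hat K^n: |a_i-z_i|\le r_i\ \forall i\}$; $\mathcal B^n$ is the set of all of these polydiscs, and $K^n\subseteq\mathcal B^n$ via $a\mapsto B_{\mathcal B}(a,0)$. For $f\in K[x_1,\dots,x_n]$ and $B\in\mathcal B^n$, $|f|(B)=\sup_{z\in B}|f(z)|$. A global minimum of $\ell$ in $\mathcal B^n$ is a $B\in\mathcal B^n$ with $\ell(B)=\inf_{B'\in\mathcal B^n}\ell(B')$. $\mathbb P^n=\mathbb P^n(K)$ contains $K^n$ as the standard affine chart $(x_1,\dots,x_n)\mapsto[x_1:\dots:x_n:1]$, and $V_i\subseteq\mathbb P^n$ is the projective hypersurface cut out by the homogenisation of $f_i$ (equivalently of $g_i$). *)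

(* Defs.v *)
From HB Require Import structures.
From mathcomp Require Import all_boot all_order all_algebra.
(* The notations of mpoly clash with those of mathcomp-analysis. *)
From mathcomp Require Import -(notations) mpoly.
From mathcomp Require Import all_classical all_reals all_analysis.

Set Implicit Arguments.
Unset Strict Implicit.
Unset Printing Implicit Defensive.

Import Order.TTheory GRing.Theory Num.Theory.
Local Open Scope classical_set_scope.
Local Open Scope ring_scope.

Definition is_valuation (R : realType) (K : fieldType) (val : K -> \bar R) :
    Prop :=
  [/\ forall x, val x != -oo%E,
      forall x, val x = +oo%E <-> x = 0,
      forall x y, val (x * y) = (val x + val y)%E &
      forall x y, (Order.min (val x) (val y) <= val (x + y)%R)%E].

Definition nontrivial_valuation (R : realType) (K : fieldType)
    (val : K -> \bar R) : Prop :=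
  exists2 x, x != 0 & val x != 0%E.

(* [expeR -oo = 0], so the absolute value of [0] is [0]. *)
Definition absval (R : realType) (K : fieldType) (val : K -> \bar R) (x : K) :
    R :=
  fine (expeR (- val x)%E).

Definition is_nonarch_absval (R : realType) (L : fieldType) (abs : L -> R) :
    Prop :=
  [/\ forall x, 0 <= abs x,
      forall x, abs x = 0 <-> x = 0,
      forall x y, abs (x * y) = abs x * abs y &
      forall x y, abs (x + y) <= Num.max (abs x) (abs y)].

Definition is_complete (R : realType) (L : fieldType) (abs : L -> R) : Prop :=
  forall u : nat -> L,
    (forall e : R, 0 < e -> exists N : nat, forall p q : nat,
       (N <= p)%N -> (N <= q)%N -> abs (u p - u q) < e) ->
    exists l : L, forall e : R, 0 < e -> exists N : nat, forall p : nat,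
      (N <= p)%N -> abs (u p - l) < e.

(* [j] makes [Kbar] an algebraic closure of [K], and [h] makes [(Khat, absH)]
   the completion of [Kbar] for the absolute value that [absH] induces on it,
   which extends [abs]. *)
Definition is_completed_alg_closure (R : realType) (K : fieldType)
    (Kbar : closedFieldType) (Khat : fieldType) (abs : K -> R)
    (absH : Khat -> R) (j : {rmorphism K -> Kbar})
    (h : {rmorphism Kbar -> Khat}) : Prop :=
  [/\ forall y : Kbar, algebraicOver j y,
      is_nonarch_absval absH,
      forall x : K, absH (h (j x)) = abs x,
      forall (z : Khat) (e : R), 0 < e -> exists y : Kbar, absH (z - h y) < e &
      is_complete absH].

Definition polydisc (R : realType) (K Khat : fieldType) (absH : Khat -> R)
    (iota : K -> Khat) (n : nat) (a : 'rV[K]_n) (r : 'rV[R]_n) :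
    set 'rV[Khat]_n :=
  [set z | forall i, absH (iota (a ord0 i) - z ord0 i) <= r ord0 i].

Definition polydiscs (R : realType) (K Khat : fieldType) (absH : Khat -> R)
    (iota : K -> Khat) (n : nat) : set (set 'rV[Khat]_n) :=
  [set B | exists (a : 'rV[K]_n) (r : 'rV[R]_n),
             (forall i, 0 <= r ord0 i) /\ B = polydisc absH iota a r].

(* A polynomial is bounded on a polydisc, which is not empty, so that the
   supremum below is a genuine one. *)
Definition abspoly (R : realType) (K Khat : fieldType) (absH : Khat -> R)
    (iota : K -> Khat) (n : nat) (f : mpoly n K) (B : set 'rV[Khat]_n) : R :=
  sup [set absH (mmap iota (z ord0) f) | z in B].

(* Used only for nonnegative [l], so that the infimum is a genuine one. *)
Definition has_global_min (R : realType) (T : Type) (D : set T) (l : T -> R) :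
    Prop :=
  exists2 x, D x & l x = inf [set l y | y in D].

Definition nonconstant (K : fieldType) (n : nat) (f : mpoly n K) : Prop :=
  ~ exists c : K, f = mpolyC n c.

Definition affine_form (K : fieldType) (n : nat) (a : 'rV[K]_n) (b : K) :
    mpoly n K :=
  \sum_(j < n) a ord0 j *: mpolyX K (mnm1 j) + mpolyC n b.

(* The points of P^n(K) are the lines of K^(n+1). *)
Definition proj_space (K : fieldType) (n : nat) : Type :=
  {L : {vspace 'rV[K]_(n + 1)} | \dim L == 1%N}.

Lemma chart_subproof (K : fieldType) (n : nat) (x : 'rV[K]_n) :
  \dim <[row_mx x (const_mx 1 : 'rV[K]_1)]>%VS == 1%N.
Proof.
rewrite dim_vline eqb1; apply/eqP => E.
have := congr1 (fun u : 'rV[K]_(n + 1) => u ord0 (rshift n ord0)) E.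
by rewrite /= row_mxEr !mxE => /eqP; rewrite oner_eq0.
Qed.

(* x |-> [x_1 : ... : x_n : 1] *)
Definition chart (K : fieldType) (n : nat) (x : 'rV[K]_n) : proj_space K n :=
  exist _ <[row_mx x (const_mx 1 : 'rV[K]_1)]>%VS (chart_subproof x).

(* The homogenising variable is the last one; [(mmeasure mdeg f).-1] is the
   total degree of [f]. *)
Definition homogenise (K : fieldType) (n : nat) (f : mpoly n K) :
    mpoly (n + 1) K :=
  \sum_(m <- msupp f) mcoeff m f *:
    ((\prod_(j < n) mpolyX K (mnm1 (lshift 1 j)) ^+ m j) *
     mpolyX K (mnm1 (rshift n ord0)) ^+ ((mmeasure mdeg f).-1 - mdeg m)).

Definition proj_hypersurface (K : fieldType) (n : nat) (f : mpoly n K) :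
    set (proj_space K n) :=
  [set L : proj_space K n | forall v : 'rV[K]_(n + 1), v \in sval L ->
     meval (v ord0) (homogenise f) = 0].

(* Main.v *)
(* A polydisc contains its centre, so l(B(a,r)) >= l(a) and it suffices to
   minimise l over K^n. For this there is a finite set of candidates: given x,
   move along a line to the nearest zero of one of the g_i, which by the
   ultrametric inequality increases no |g_k|, and repeat inside the zero locus
   of g_i. Once no direction is left, all the g_k are constant on the locus
   reached, and one point of each such locus suffices. *)
Require Import Defs.
From HB Require Import structures.
From mathcomp Require Import all_boot all_order all_algebra.
From mathcomp Require Import -(notations) mpoly.
From mathcomp Require Import all_classical all_reals all_analysis.

Set Implicit Arguments.
Unset Strict Implicit.
Unset Printing Implicit Defensive.

Import Order.TTheory GRing.Theory Num.Theory.
Local Open Scope classical_set_scope.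
Local Open Scope ring_scope.

Lemma nonarch_absval1 (R : realType) (L : fieldType) (abs : L -> R) :
  is_nonarch_absval abs -> abs 1 = 1.
Proof.
case=> _ abs0 absM _; have n0 : abs 1 != 0.
  by apply/eqP => /abs0/eqP; rewrite oner_eq0.
by apply: (mulfI n0); rewrite -absM !mulr1.
Qed.

Lemma nonarch_absvalN (R : realType) (L : fieldType) (abs : L -> R) (x : L) :
  is_nonarch_absval abs -> abs (- x) = abs x.
Proof.
move=> habs; have [abs_ge0 _ absM _] := habs.
have /eqP : abs (-1) ^+ 2 = 1.
  by rewrite expr2 -absM mulrNN mulr1 nonarch_absval1.
rewrite sqrf_eq1 => /orP[] /eqP absN1.
  by rewrite -mulN1r absM absN1 mul1r.
by have := abs_ge0 (-1); rewrite absN1 oppr_ge0 ler10.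
Qed.

Lemma nonarch_absvalX (R : realType) (L : fieldType) (abs : L -> R) (x : L)
    (k : nat) :
  is_nonarch_absval abs -> abs (x ^+ k) = abs x ^+ k.
Proof.
move=> habs; have [_ _ absM _] := habs.
elim: k => [|k IHk]; first by rewrite !expr0 nonarch_absval1.
by rewrite !exprS absM IHk.
Qed.

(** Additive bounds are enough for the finiteness of suprema over polydiscs. *)
Lemma nonarch_absval_leD (R : realType) (L : fieldType) (abs : L -> R)
    (x y : L) :
  is_nonarch_absval abs -> abs (x + y) <= abs x + abs y.
Proof.
case=> abs_ge0 _ _ absD; apply: (le_trans (absD x y)).
by rewrite ge_max lerDl lerDr !abs_ge0.
Qed.

Lemma nonarch_absval_le_sum (R : realType) (L : fieldType) (abs : L -> R)
    (I : finType) (F : I -> L) :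
  is_nonarch_absval abs -> abs (\sum_i F i) <= \sum_i abs (F i).
Proof.
move=> habs; have [_ abs0 _ _] := habs.
apply: (big_ind2 (fun x y => abs x <= y)) => //.
- by rewrite (abs0 0).2.
- move=> x1 x2 y1 y2 le1 le2; apply: (le_trans (nonarch_absval_leD _ _ habs)).
  exact: lerD.
Qed.

(** Pulls [absH] back to K, where the candidates live; definiteness survives because field morphisms
    are injective. *)
Lemma nonarch_absval_comp (R : realType) (K L : fieldType) (abs : L -> R)
    (iota : {rmorphism K -> L}) :
  is_nonarch_absval abs -> is_nonarch_absval (abs \o iota).
Proof.
case=> abs_ge0 abs0 absM absD; split=> [x|x|x y|x y] /=.
- exact: abs_ge0.
- rewrite abs0; split=> [/eqP|->]; last exact: rmorph0.
  by rewrite fmorph_eq0 => /eqP.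
- by rewrite rmorphM absM.
- by rewrite rmorphD absD.
Qed.

(* On the line [x + t v] take the zero nearest to [x], at distance [abs t] say:
   the forms whose zero is at least that far do not grow, by the ultrametric
   inequality. *)
Lemma nearest_zero (R : realType) (K : fieldType) (abs : K -> R)
    (V : lmodType K) (I : finType) (g dg : I -> V -> K) (x v : V) (k : I) :
    is_nonarch_absval abs ->
    (forall i y w t, g i (y + t *: w) = g i y + t * dg i w) ->
    dg k v != 0 ->
  exists i t, [/\ dg i v != 0, g i (x + t *: v) = 0 &
    forall l, abs (g l (x + t *: v)) <= abs (g l x)].
Proof.
move=> habs gE nzk; have [abs_ge0 _ absM absD] := habs.
(* The parameter at which [g i] vanishes on the line; meaningful only if [dg i v != 0], to which the
   minimum below is restricted. *)
pose t i := - g i x / dg i v.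
case: (@Order.TotalTheory.arg_minP _ _ _ k (fun i => dg i v != 0)
  (fun i => abs (t i)) nzk) => i nzi min_i.
exists i, (t i); split=> // [|l]; first by rewrite gE divfK // subrr.
rewrite gE; have [->|nzl] := eqVneq (dg l v) 0; first by rewrite mulr0 addr0.
(* By minimality the increment is at most [abs (t l * dg l v)], which equals [abs (g l x)]. *)
apply: (le_trans (absD _ _)); rewrite ge_max lexx absM /=.
apply: le_trans (ler_wpM2r (abs_ge0 _) (min_i l nzl)) _.
by rewrite -absM divfK // nonarch_absvalN.
Qed.

(* Induction on the number of forms not in [S]: either some direction preserves
   the zero locus of [S] and moves one of the other forms, and [nearest_zero]
   enlarges [S], or all the forms are constant on that locus. *)
Lemma finite_dominating (R : realType) (K : fieldType) (abs : K -> R)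
    (V : lmodType K) (I : finType) (g dg : I -> V -> K) (S : {set I}) :
    is_nonarch_absval abs ->
    (forall i y w t, g i (y + t *: w) = g i y + t * dg i w) ->
  exists P : seq V, forall x, (forall i, i \in S -> g i x = 0) ->
    exists2 p, p \in P & forall i, abs (g i p) <= abs (g i x).
Proof.
move=> habs gE; have [N] := ubnP #|~: S|; elim: N => // N IHN in S * => ltSN.
have [[v [k [dS0 nzk]]]|const] :=
    pselect (exists v k, (forall i, i \in S -> dg i v = 0) /\ dg k v != 0).
  (* Which form vanishes first depends on [x], so every index outside [S] gets its own list and the
     lists are concatenated. Indices in [S] get a dummy list. *)
  have /choice[Q QP] (i : I) : exists P : seq V, i \notin S ->
      forall x, (forall l, l \in i |: S -> g l x = 0) ->
      exists2 p, p \in P & forall l, abs (g l p) <= abs (g l x).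
    have [iS|iS] := boolP (i \in S); first by exists [::].
    have [|P PP] := IHN (i |: S); last by exists P.
    apply: leq_trans (ltSN : (#|_| <= _)%N); apply: proper_card.
    rewrite finset.properC properE finset.subsetUr finset.subUset.
    by rewrite finset.sub1set (negPf iS).
  exists (flatten [seq Q i | i <- enum I]) => x xS.
  have [i [t [nzi gi0 dom]]] := nearest_zero x habs gE nzk.
  have iS : i \notin S by apply: contraNN nzi => /dS0->.
  have [|p pQ pdom] := QP i iS (x + t *: v).
    by move=> l /setU1P[->//|lS]; rewrite gE xS // dS0 // mulr0 addr0.
  exists p => [|l]; last exact: le_trans (pdom l) (dom l).
  by apply/flatten_mapP; exists i; rewrite ?mem_enum.
(* No direction is left: any point of the locus serves for all of it, and an empty locus needs no
   candidate. *)
have [[x0 x0S]|noS] := pselect (exists x, forall i, i \in S -> g i x = 0).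
  exists [:: x0] => x xS; exists x0; rewrite ?mem_head // => i.
  have gx0 l : g l x0 = g l x + dg l (x0 - x).
    by rewrite -[dg l _]mul1r -gE scale1r subrKC.
  suff -> : g i x0 = g i x by [].
  rewrite gx0; have [->|nz] := eqVneq (dg i (x0 - x)) 0; first by rewrite addr0.
  (* The forms in [S] vanish at both points, so [x0 - x] would be a direction of the kind excluded
     by [const]. *)
  exfalso; apply: const; exists (x0 - x), i; split=> // l lS.
  by have := gx0 l; rewrite x0S // xS // add0r => <-.
by exists [::] => x xS; exfalso; apply: noS; exists x.
Qed.

Lemma seq_argmin (R : realType) (T : eqType) (F : T -> R) (s : seq T) (x : T) :
  x \in s -> exists2 p, p \in s & forall q, q \in s -> F p <= F q.
Proof.
elim: s x => // y s IHs x _; case: s => [|z s] in IHs *.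
  by exists y => [|q]; rewrite inE // => /eqP->.
have [p ps pmin] := IHs z (mem_head _ _).
have [le_yp|/ltW le_py] := leP (F y) (F p).
  exists y => [|q]; first exact: mem_head.
  by rewrite inE => /predU1P[->//|/pmin]; apply: le_trans.
exists p => [|q]; first by rewrite inE ps orbT.
by rewrite inE => /predU1P[->//|/pmin].
Qed.

(** The value of [affine_form a b] at a point of K^n, as a matrix product so that bilinearity yields
    [affine_evalD]. *)
Definition affine_eval (K : fieldType) (n : nat) (a : 'rV[K]_n) (b : K)
    (x : 'rV[K]_n) : K := (x *m a^T) ord0 ord0 + b.

(** The hypothesis [gE] of [finite_dominating], with the linear part as [dg]. *)
Lemma affine_evalD (K : fieldType) (n : nat) (a : 'rV[K]_n) (b : K)
    (x v : 'rV[K]_n) (t : K) :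
  affine_eval a b (x + t *: v) =
  affine_eval a b x + t * (v *m a^T) ord0 ord0.
Proof. by rewrite /affine_eval mulmxDl -scalemxAl !mxE addrAC. Qed.

Lemma mmap_affine_formX (K L : fieldType) (iota : {rmorphism K -> L}) (n : nat)
    (a : 'rV[K]_n) (b : K) (k : nat) (z : 'rV[L]_n) :
  mmap iota (z ord0) (affine_form a b ^+ k) =
  (\sum_j iota (a ord0 j) * z ord0 j + iota b) ^+ k.
Proof.
rewrite rmorphXn /= /affine_form mmapD mmapC raddf_sum /=; congr ((_ + _) ^+ _).
by apply: eq_bigr => i _; rewrite mmapZ mmapX mmap1U.
Qed.

Lemma mmap_affine_formX_map (K L : fieldType) (iota : {rmorphism K -> L})
    (n : nat) (a : 'rV[K]_n) (b : K) (k : nat) (x : 'rV[K]_n) :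
  mmap iota ((map_mx iota x) ord0) (affine_form a b ^+ k) =
  iota (affine_eval a b x) ^+ k.
Proof.
rewrite mmap_affine_formX /affine_eval rmorphD mxE rmorph_sum /=.
congr ((_ + _) ^+ _).
by apply: eq_bigr => i _; rewrite !mxE rmorphM mulrC.
Qed.

Lemma polydisc_center (R : realType) (K L : fieldType) (absH : L -> R)
    (iota : {rmorphism K -> L}) (n : nat) (x : 'rV[K]_n) (r : 'rV[R]_n) :
    is_nonarch_absval absH -> (forall i, 0 <= r ord0 i) ->
  polydisc absH iota x r (map_mx iota x).
Proof.
by case=> _ abs0 _ _ r_ge0 i; rewrite !mxE subrr (abs0 0).2.
Qed.

Lemma polydisc0 (R : realType) (K L : fieldType) (absH : L -> R)
    (iota : {rmorphism K -> L}) (n : nat) (x : 'rV[K]_n) :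
    is_nonarch_absval absH ->
  polydisc absH iota x 0 = [set map_mx iota x].
Proof.
move=> habs; have [abs_ge0 abs0 _ _] := habs.
apply/seteqP; split=> z /= => [hz|->]; last first.
  by apply: polydisc_center => // i; rewrite mxE.
apply/rowP => i; rewrite mxE; apply/esym/eqP; rewrite -subr_eq0; apply/eqP/abs0.
by apply/le_anti; rewrite abs_ge0 andbT; have := hz i; rewrite mxE.
Qed.

Lemma abspoly_polydisc0 (R : realType) (K L : fieldType) (absH : L -> R)
    (iota : {rmorphism K -> L}) (n : nat) (a : 'rV[K]_n) (b : K) (k : nat)
    (x : 'rV[K]_n) :
    is_nonarch_absval absH ->
  abspoly absH iota (affine_form a b ^+ k) (polydisc absH iota x 0) =
  absH (iota (affine_eval a b x)) ^+ k.
Proof.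
move=> habs; rewrite /abspoly polydisc0 // image_set1 sup1.
by rewrite mmap_affine_formX_map nonarch_absvalX.
Qed.

(** The centre lies in the polydisc; what remains is to bound the values there, since [sup]
    dominates the members of a set only if the set is bounded above. *)
Lemma abspoly_ge_center (R : realType) (K L : fieldType) (absH : L -> R)
    (iota : {rmorphism K -> L}) (n : nat) (a : 'rV[K]_n) (b : K) (k : nat)
    (x : 'rV[K]_n) (r : 'rV[R]_n) :
    is_nonarch_absval absH -> (forall i, 0 <= r ord0 i) ->
  absH (iota (affine_eval a b x)) ^+ k <=
  abspoly absH iota (affine_form a b ^+ k) (polydisc absH iota x r).
Proof.
move=> habs r_ge0; have [abs_ge0 _ absM _] := habs.
apply: ub_le_sup; last first.
  exists (map_mx iota x); first exact: polydisc_center.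
  by rewrite mmap_affine_formX_map nonarch_absvalX.
(* On the polydisc each [z ord0 j] has absolute value at most that of the centre's coordinate plus
   the radius. *)
exists ((\sum_j absH (iota (a ord0 j)) * (absH (iota (x ord0 j)) + r ord0 j) +
  absH (iota b)) ^+ k) => _ [z hz <-].
have le_hz : absH (\sum_j iota (a ord0 j) * z ord0 j + iota b) <=
    \sum_j absH (iota (a ord0 j)) * (absH (iota (x ord0 j)) + r ord0 j) +
    absH (iota b).
  apply: (le_trans (nonarch_absval_leD _ _ habs)); rewrite lerD2r.
  apply: (le_trans (nonarch_absval_le_sum _ habs)); apply: ler_sum => i _.
  rewrite absM ler_wpM2l //.
  have -> : z ord0 i = iota (x ord0 i) + - (iota (x ord0 i) - z ord0 i).
    by rewrite opprB subrKC.
  apply: (le_trans (nonarch_absval_leD _ _ habs)).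
  by rewrite nonarch_absvalN // lerD2l.
rewrite mmap_affine_formX nonarch_absvalX //.
by apply: lerXn2r; rewrite ?nnegrE // (le_trans (abs_ge0 _) le_hz).
Qed.


Theorem theorem55 (R : realType) (K : fieldType) (val : K -> \bar R)
    (Kbar : closedFieldType) (Khat : fieldType) (absH : Khat -> R)
    (j : {rmorphism K -> Kbar}) (h : {rmorphism Kbar -> Khat})
    (hval : is_valuation val)
    (hnontrivial : nontrivial_valuation val)
    (hcomplete : is_complete (absval val))
    (hKhat : is_completed_alg_closure (absval val) absH j h)
    (n m : nat) (a : 'I_m -> R) (f : 'I_m -> mpoly n K)
    (e : 'I_m -> nat) (A : 'I_m -> 'rV[K]_n) (b : 'I_m -> K)
    (ha : forall i, 0 < a i)
    (hf : forall i, nonconstant (f i))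
    (he : forall i, (0 < e i)%N)
    (hfg : forall i, f i = affine_form (A i) (b i) ^+ e i) :
  let l := fun B : set 'rV[Khat]_n =>
    \sum_(i < m) a i * abspoly absH (h \o j) (f i) B in
  let V := \bigcap_(i in [set: 'I_m]) proj_hypersurface (f i) in
  let Kn := range (@chart K n) in
  (V `&` Kn !=set0 \/ V = set0 ->
     has_global_min (polydiscs absH (h \o j) (n := n)) l) /\
  (V `\` Kn = set0 -> has_global_min (polydiscs absH (h \o j) (n := n)) l).
Proof.
move=> l V Kn; have [_ habsH _ _ _] := hKhat.
have habs : is_nonarch_absval (absH \o (h \o j)) by exact: nonarch_absval_comp.
have [abs_ge0 _ _ _] := habs.
suff lmin : has_global_min (polydiscs absH (h \o j) (n := n)) l by split.
pose F x := l (polydisc absH (h \o j) x 0).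
have FE x : F x =
    \sum_(i < m) a i * absH (h (j (affine_eval (A i) (b i) x))) ^+ e i.
  by apply: eq_bigr => i _; rewrite hfg abspoly_polydisc0.
have [P Pdom] := finite_dominating (finset.set0 : {set 'I_m}) habs
  (fun i => affine_evalD (A i) (b i)).
(* The point 0 is arbitrary: it only shows that [P] is nonempty. *)
have [|p0 p0P _] := Pdom 0; first by move=> i; rewrite finset.in_set0.
have [p pP pmin] := seq_argmin F p0P.
have discp x : polydiscs absH (h \o j) (polydisc absH (h \o j) x 0).
  by exists x, 0; split=> // i; rewrite mxE.
(* For a polydisc with centre [x], a candidate [q] dominating [x] gives F(p) <= F(q) <= F(x) <=
   l(B). *)
have lb : lbound [set l B | B in polydiscs absH (h \o j) (n := n)] (F p).
  move=> _ [_ [x [r [r_ge0 ->]]] <-].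
  have [|q qP qdom] := Pdom x; first by move=> i; rewrite finset.in_set0.
  apply: (le_trans (pmin q qP)); rewrite FE; apply: ler_sum => i _.
  rewrite hfg; apply: ler_wpM2l; first exact: ltW (ha i).
  apply: le_trans (abspoly_ge_center (h \o j) _ _ _ _ habsH r_ge0).
  by apply: lerXn2r; rewrite ?nnegrE; [exact: abs_ge0..|exact: qdom].
exists (polydisc absH (h \o j) p 0) => //; apply/le_anti/andP; split.
  by apply: lb_le_inf => //; exists (F p); exists (polydisc absH (h \o j) p 0).
by apply: ge_inf; [exists (F p)|exists (polydisc absH (h \o j) p 0)].
Qed.
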